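(* If $F$ is a face in a convex subset $C$ of $\mathbb R^n$, then there is a unique sequence $$F_1\supset\cdots\supset F_k$$ such that (1) $F_1$ is the unique minimal exposed face in $C$ containing $F$; (2) if $1<i\le k$, then $F_i$ is the unique minimal exposed face of $F_{i-1}$ that contains $F$; (3) $F=F_k$.
   Context: A face of a convex set $C$ is meant in the usual sense of convexity: a convex subset $G\subset C$ such that whenever a relative interior point of a line segment in $C$ lies in $G$, the whole segment lies in $G$. For nonzero $\mathbf t\in\mathbb R^n$ and $\alpha\in\mathbb R$, write $P(\mathbf t,\alpha)=\{\mathbf x\in\mathbb R^n:\langle\mathbf t,\mathbf x\rangle=\alpha\}$ and $P^{\uparrow}(\mathbf t,\alpha)=\{\mathbf x\in\mathbb R^n:\langle\mathbf t,\mathbf x\rangle\ge\alpha\}$. The hyperplane $P(\mathbf t,\alpha)$ is a hyperplane of support for $C$ if it contains a vector in the boundary of $C$ and $C\subset P^{\uparrow}(\mathbf t,\alpha)$. A face $G$ of $C$ is exposed if there is a hyperplane of support $P$ for $C$ such that $G=C\cap P$. The minimal exposed face of $C$ containing $F$ is the intersection of all exposed faces of $C$ that contain $F$. The same terms are used with the convex set $F_{i-1}$ in place of $C$.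
   Formalization: The face F is assumed nonempty (for C=[0,∞), F=∅ the claim fails); the inclusions are read as strict, as uniqueness needs; and if F=C, where there may be no exposed face containing F, the minimal exposed face is taken to be C itself. *)

(* Defs.v *)
From mathcomp Require Import all_boot all_order all_algebra.
From mathcomp Require Import all_classical all_reals all_analysis.

Set Implicit Arguments.
Unset Strict Implicit.
Unset Printing Implicit Defensive.

Import Order.TTheory GRing.Theory Num.Theory.
Import numFieldNormedType.Exports.

Local Open Scope classical_set_scope.
Local Open Scope ring_scope.

Section faces.
Context {R : realType} {n : nat}.
Local Notation V := 'rV[R]_n.
Implicit Types (x y t : V) (a : R) (C F G : set V).

Definition segment x y : set V :=
  [set (1 - s) *: x + s *: y | s in `[0, 1]].

Definition relint_segment x y : set V :=
  [set (1 - s) *: x + s *: y | s in `]0, 1[].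

(* The empty set is not excluded here. *)
Definition face C G : Prop :=
  [/\ G `<=` C, convex_set (G : set (convex_lmodType V)) &
      forall x y, segment x y `<=` C ->
        relint_segment x y `&` G !=set0 -> segment x y `<=` G].

Definition dot t x : R := \sum_(i < n) t ord0 i * x ord0 i.

Definition hyperplane t a : set V := [set x | dot t x = a].

Definition upper_halfspace t a : set V := [set x | a <= dot t x].

Definition boundary C : set V := closure C `\` interior C.

(* The boundary is taken in R^n, not in the affine hull of C; so a nonempty C
   lying in a hyperplane is an exposed face of itself. *)
Definition support_hyperplane C t a : Prop :=
  [/\ t != 0, hyperplane t a `&` boundary C !=set0 &
      C `<=` upper_halfspace t a].

Definition exposed_face C G : Prop :=
  face C G /\
  exists t a, support_hyperplane C t a /\ G = C `&` hyperplane t a.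

(* The intersection is formed among the subsets of C: it is C when no exposed
   face of C contains F. *)
Definition exposed_hull C F : set V :=
  C `&` \bigcap_(G in [set G | exposed_face C G /\ F `<=` G]) G.

(* "G is the unique minimal exposed face of C containing F". For F = C it says
   only that G = C, since C need not be an exposed face of itself (for instance
   when it has interior points). *)
Definition minimal_exposed_face C F G : Prop :=
  G = exposed_hull C F /\ (F <> C -> exposed_face C G).

End faces.

(* Main.v *)
Require Import Defs.
From HB Require Import structures.
From mathcomp Require Import all_boot all_order all_algebra.
From mathcomp Require Import all_classical all_reals all_analysis.
From mathcomp Require Import ring lra.

Set Implicit Arguments.
Unset Strict Implicit.
Unset Printing Implicit Defensive.

Import Order.TTheory GRing.Theory Num.Theory.
Import numFieldNormedType.Exports.

Local Open Scope classical_set_scope.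
Local Open Scope ring_scope.

(** The theorem comes down to one fact: a face [F] of a convex set [C], other
than [C] itself, lies in a hyperplane of support that does not contain [C]
([proper_support]). Granting this, the exposed hull [G] of [F] in [C] is a
proper subset of [C], it is cut out of [C] by a hyperplane, and [F] is again a
face of [G]. Replacing [C] by [G] lowers the dimension, so after finitely many
steps the hull is [F] itself ([face_chain_exists]). The sequence is unique
because each term is determined by the previous one and because it cannot go on
once [F] is reached, [F] being its own hull in [F] ([face_chain_unique]).

Both geometric inputs rest on order units. An order unit of a convex cone [K] is
a vector [u] of [K] some multiple of which dominates any given vector of [K]; in
finite dimension one exists, namely the sum of finitely many vectors of [K] that
span [K] ([cone_has_order_unit]).

- Proper support. Let [K] be the cone generated by the differences [c - f] with
  [c] in [C] and [f] in [F]. As [F] is a face, [f - c] is outside [K] when [c] is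
  outside [F]: otherwise a point of [F] would lie strictly between [c] and
  another point of [C]. So [K] is not a linear subspace, and then [- u] is
  outside [K] for an order unit [u]. A functional that is nonnegative on [K] and
  equal to 1 at [u] is constant on [F], minimal over [C] there, and not constant
  on [C]. It is found by adding lines to [K], one for each basis vector, while
  keeping [- u] outside ([cone_supporting_functional]); each line is chosen with
  a supremum, as in the Hahn-Banach theorem.

- The hull is exposed. The functionals whose minimum over [C] is attained at all
  points of [F] form a convex cone. If [u] is an order unit of that cone, then a
  point of [C] where [u] is minimal minimizes every functional of the cone, so
  the hyperplane of [u] cuts out the intersection of all exposed faces containing
  [F] ([exposed_hull_functional]). *)

(** * Convex cones and order units *)

Section cones.
Context {R : realType} {V : vectType R}.
Implicit Types (x y u v w : V) (K S : set V).

Definition convex_cone K : Prop :=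
  [/\ K 0, forall x y, K x -> K y -> K (x + y) &
      forall a x, 0 <= a -> K x -> K (a *: x)].

Definition order_unit K u : Prop :=
  K u /\ forall x, K x -> exists2 a, 0 <= a & K (a *: u - x).

(** As long as some vector of [S] is outside the span, adding it to the sequence
raises the dimension of the span; [m] bounds the number of additions left. *)
Lemma finite_spanning_seq S : exists s : seq V,
  (forall x, x \in s -> S x) /\ forall x, S x -> x \in span s.
Proof.
suff main m (s : seq V) : (\dim {:V} - \dim (span s) <= m)%N ->
    (forall x, x \in s -> S x) ->
    exists s : seq V,
    (forall x, x \in s -> S x) /\ forall x, S x -> x \in span s.
  by apply: (main (\dim {:V}) [::]); rewrite ?leq_subr.
elim: m s => [|m IH] s sm sS.
  exists s; split=> // x _; suff -> : span s = {:V}%VS by rewrite memvf.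
  by apply/eqP; rewrite eqEdim subvf /= -subn_eq0 -leqn0.
have [ss|/existsNP[x /not_implyP[Sx xs]]] := pselect (forall x, S x -> x \in span s).
  by exists s.
apply: (IH (x :: s)); last by move=> y; rewrite inE => /orP[/eqP->//|/sS].
have sub : (span s <= span (x :: s))%VS by rewrite span_cons addvSr.
have : (\dim (span s) < \dim (span (x :: s)))%N.
  rewrite (ltn_leqif (dimv_leqif_sup sub)); apply/negP => /subvP/(_ x).
  by move=> h; apply: xs; apply: h; rewrite memv_span ?mem_head.
move: sm; set a := (\dim (span s))%N; set b := (\dim (span (x :: s)))%N.
by rewrite !leq_subLR => h ab; apply: (leq_trans h); rewrite addnS -addSn leq_add2r.
Qed.

Lemma cone_sum K (I : Type) (r : seq I) (P : pred I) (f : I -> V) :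
  convex_cone K -> (forall i, P i -> K (f i)) -> K (\sum_(i <- r | P i) f i).
Proof.
by case=> K0 KD KZ Kf; elim/big_ind: _.
Qed.

(** The sum of a finite family in [K] that spans [K] works: if [x] has
coordinates [c i] in this family, then a multiple larger than all of the [c i]
makes the coordinates of [a *: u - x] nonnegative. *)
Lemma cone_has_order_unit K : convex_cone K -> exists u, order_unit K u.
Proof.
move=> cK; have [s [sK Ks]] := finite_spanning_seq K.
have KsK (i : 'I_(size s)) : K s`_i by apply: sK; rewrite mem_nth.
exists (\sum_(i < size s) s`_i); split; first exact: cone_sum.
move=> x /Ks xs.
pose c i := coord (in_tuple s) i x.
have c_le i : c i <= \sum_j `|c j|.
  rewrite (bigD1 i)//= (le_trans (ler_norm _))// lerDl.
  by apply: sumr_ge0 => ? _.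
exists (\sum_j `|c j|); first by apply: sumr_ge0 => ? _.
have -> : x = \sum_i c i *: s`_i by exact: (coord_span (X := in_tuple s)).
rewrite scaler_sumr -sumrB; apply: cone_sum => // i _.
case: cK => _ _ KZ; rewrite -scalerBl; apply: KZ => //.
by rewrite subr_ge0.
Qed.

(** The cone [K + R w]. *)
Definition add_line K w : set V := [set x | exists s, K (x + s *: w)].

Lemma add_line_cone K w : convex_cone K -> convex_cone (add_line K w).
Proof.
case=> K0 KD KZ; split.
- by exists 0; rewrite scale0r addr0.
- move=> x y [s Ks] [r Kr]; exists (s + r).
  by rewrite scalerDl addrACA; apply: KD.
- move=> a x a0 [s Ks]; exists (a * s).
  by rewrite -scalerA -scalerDr; apply: KZ.
Qed.

Lemma sub_add_line K w : K `<=` add_line K w.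
Proof. by move=> x Kx; exists 0; rewrite scale0r addr0. Qed.

Lemma add_line_order_unit K u w : order_unit K u -> order_unit (add_line K w) u.
Proof.
move=> [Ku uK]; split; first exact: sub_add_line.
move=> x [s /uK[a a0 Ka]]; exists a => //; exists (- s).
by rewrite scaleNr -addrA -opprD.
Qed.

(** The one-dimensional extension step of the Hahn-Banach theorem. Order vectors
by [K]: the multiples [b *: u] below [v] and the multiples [a *: u] above [v]
satisfy [b <= a], since [- u] is outside [K]. Any [r] that separates the two
kinds of coefficients works, and the supremum of the first kind is one. That [u]
is an order unit ensures that if one kind of coefficient exists then so does the
other. When neither exists, any [r] will do and the supremum of the empty set is
0. *)
Lemma add_line_avoids_neg_unit K u v : convex_cone K -> order_unit K u ->
  ~ K (- u) -> exists r, ~ add_line K (v - r *: u) (- u).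
Proof.
move=> cK [Ku uK] Ku'; have [K0 KD KZ] := cK.
have le_coef (a b : R) : K (a *: u - v) -> K (v - b *: u) -> b <= a.
  move=> Ka Kb; rewrite leNgt; apply/negP => ab; apply: Ku'.
  have := KD _ _ Ka Kb; rewrite addrA subrK -scalerBl => Kab.
  have ba : 0 < b - a by rewrite subr_gt0.
  have := KZ ((b - a)^-1) _ (ltW (_ : 0 < _)) Kab.
  rewrite invr_gt0 scalerA -(opprB b a) mulrN mulVf ?gt_eqF// scaleN1r; exact.
pose B := [set b | K (v - b *: u)].
have ubB a : K (a *: u - v) -> ubound B a.
  by move=> Ka b /= Kb; apply: le_coef Kb.
have KvB a : K (a *: u - v) -> B !=set0.
  move=> /uK[c _ Kc]; exists (a - c); rewrite /B/=.
  by move: Kc; rewrite scalerBl !opprB addrCA; congr (K (_ + _)).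
have BvK b : B b -> exists a, K (a *: u - v).
  move=> /uK[c _ Kc]; exists (c + b).
  by move: Kc; rewrite scalerDl opprB addrA.
exists (sup B) => -[s].
(* If the new cone contained [- u], dividing by [`|s|] would give a lower
   coefficient [sup B + s^-1] above [sup B] when [0 < s], and an upper one below
   [sup B] when [s < 0]. *)
have [->|s0] := eqVneq s 0; first by rewrite scale0r addr0.
move=> Ks.
have Ks' := KZ (`|s|^-1) _ (ltW (_ : 0 < _)) Ks.
move: Ks'; rewrite invr_gt0 normr_gt0 => /(_ s0).
have [sp|sn] := ltrP 0 s.
  rewrite gtr0_norm// => K1.
  have Bb : B (sup B + s^-1).
    rewrite /B/=; move: K1; congr K.
    rewrite scalerDr scalerA mulVf// scale1r scalerN scalerDl.
    by rewrite addrC -addrA -opprD.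
  have [a Ka] := BvK _ Bb.
  have hB : has_sup B by split; [exists (sup B + s^-1)|exists a; exact: ubB].
  have := sup_upper_bound hB Bb.
  by rewrite gerDl leNgt invr_gt0 sp.
have {}sn : s < 0 by rewrite lt_neqAle s0.
rewrite ltr0_norm// => K1.
have Ka : K ((sup B + s^-1) *: u - v).
  move: K1; congr K.
  rewrite scalerDr scalerA invrN mulNr mulVf// scaleN1r scalerN scaleNr opprK.
  by rewrite opprB scalerDl addrCA addrA.
have := ge_sup (KvB _ Ka) (ubB _ Ka).
by rewrite lerDl leNgt invr_lt0 sn.
Qed.

(** Modulo the lineality space of the enlarged cone [K'], each vector of [b] is a
multiple of [u]; these multiples are the values of the functional sought. *)
Lemma cone_add_lines K u (b : seq V) :
  convex_cone K -> order_unit K u -> ~ K (- u) ->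
  exists K', [/\ convex_cone K', K `<=` K', ~ K' (- u) &
    forall v, v \in b -> exists r, K' (v - r *: u) /\ K' (r *: u - v)].
Proof.
elim: b K => [|v b IH] K cK uK Ku; first by exists K; split.
have [r Kr] := add_line_avoids_neg_unit v cK uK Ku.
have [K' [cK' KK' K'u K'b]] :=
  IH _ (add_line_cone (v - r *: u) cK) (add_line_order_unit _ uK) Kr.
exists K'; split=> //; first by move=> x /(@sub_add_line K (v - r *: u))/KK'.
have K0 : K 0 by case: cK.
move=> x; rewrite inE => /orP[/eqP->|/K'b//]; exists r; split; apply: KK'.
  by exists (-1); rewrite scaleN1r subrr.
by exists 1; rewrite scale1r addrC subrKA subrr.
Qed.

End cones.

(** * The supporting functional of a cone *)

Section dot.
Context {R : realType} {n : nat}.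
Local Notation V := 'rV[R]_n.
Implicit Types (x y t : V) (a : R).

Lemma dotC x y : dot x y = dot y x.
Proof. by apply: eq_bigr => i _; rewrite mulrC. Qed.

Lemma dotDr t x y : dot t (x + y) = dot t x + dot t y.
Proof. by rewrite -big_split; apply: eq_bigr => i _; rewrite mxE mulrDr. Qed.

Lemma dotZr t a x : dot t (a *: x) = a * dot t x.
Proof. by rewrite mulr_sumr; apply: eq_bigr => i _; rewrite mxE mulrCA. Qed.

Lemma dotNr t x : dot t (- x) = - dot t x.
Proof. by rewrite -scaleN1r dotZr mulN1r. Qed.

Lemma dotBr t x y : dot t (x - y) = dot t x - dot t y.
Proof. by rewrite dotDr dotNr. Qed.

Lemma dotDl x y t : dot (x + y) t = dot x t + dot y t.
Proof. by rewrite dotC dotDr !(dotC t). Qed.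

Lemma dotZl a x t : dot (a *: x) t = a * dot x t.
Proof. by rewrite dotC dotZr dotC. Qed.

Lemma dotBl x y t : dot (x - y) t = dot x t - dot y t.
Proof. by rewrite dotC dotBr !(dotC t). Qed.

Lemma dot0l t : dot 0 t = 0.
Proof. by rewrite -(scale0r (0 : V)) dotZl mul0r. Qed.

Lemma dot_self_gt0 t : t != 0 -> 0 < dot t t.
Proof.
move=> t0; rewrite lt_neqAle eq_sym; apply/andP; split; last first.
  by apply: sumr_ge0 => i _; rewrite -expr2 sqr_ge0.
apply: contra t0; rewrite /dot psumr_eq0; last first.
  by move=> i _; rewrite -expr2 sqr_ge0.
move=> /allP t0; apply/eqP/rowP => i; rewrite mxE; apply/eqP.
by have := t0 i (mem_index_enum i); rewrite mulf_eq0 orbb.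
Qed.

(** After a line has been added for each vector of the canonical basis, every
[x] is congruent to a multiple [dot t x *: u] modulo the lineality space of [K'].
If [x] is in [K'], this multiple is in [K'] too, hence nonnegative because
[- u] is outside [K']. *)
Lemma cone_supporting_functional (K : set V) u : convex_cone K -> order_unit K u ->
  ~ K (- u) -> exists t, dot t u = 1 /\ forall x, K x -> 0 <= dot t x.
Proof.
move=> cK uK Ku.
have [K' [cK' KK' K'u K'b]] :=
  cone_add_lines [seq delta_mx ord0 i | i : 'I_n] cK uK Ku.
have /choice[r Kr] : forall i : 'I_n, exists r,
    K' (delta_mx ord0 i - r *: u) /\ K' (r *: u - delta_mx ord0 i).
  by move=> i; apply: K'b; apply: map_f; rewrite mem_enum.
pose t : V := \row_i r i.
have K'D x y : K' x -> K' y -> K' (x + y) by case: cK' => _ + _; exact.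
have K'Z a x : 0 <= a -> K' x -> K' (a *: x) by case: cK' => _ _; exact.
have Kt x : K' (dot t x *: u - x).
  rewrite {2}[x]row_sum_delta scaler_suml -sumrB; apply: cone_sum => // i _.
  rewrite mxE mulrC -scalerA -scalerBr.
  have [xi|xi] := lerP 0 (x ord0 i); first by apply: K'Z => //; exact: (Kr i).2.
  rewrite -opprB scalerN -scaleNr; apply: K'Z; first by rewrite oppr_ge0 ltW.
  exact: (Kr i).1.
have K'neg a : a < 0 -> ~ K' (a *: u).
  move=> a0 Ka; apply: K'u; rewrite -scaleN1r -(mulVf (ltr0_neq0 a0)).
  by rewrite -mulNr -scalerA; apply: K'Z => //; rewrite oppr_ge0 invr_le0 ltW.
have tK' x : K' x -> 0 <= dot t x.
  move=> Kx; rewrite leNgt; apply/negP => /K'neg; apply.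
  by rewrite -(subrK x (dot t x *: u)); apply: K'D => //; exact: Kt.
exists t; split; last by move=> x /KK'/tK'.
apply/eqP; rewrite eq_le; apply/andP; split; rewrite leNgt; apply/negP => h.
  have := Kt (- u); rewrite dotNr opprK -[X in _ + X]scale1r -scalerDl.
  by apply: K'neg; rewrite addrC subr_lt0.
have := Kt u; rewrite -[X in _ - X]scale1r -scalerBl; apply: K'neg.
by rewrite subr_lt0.
Qed.

End dot.

(** * Convex sets and faces *)

Lemma convex_setP {R : realType} {V : lmodType R} (C : set V) :
  convex_set (C : set (convex_lmodType V)) <->
  forall x y s, 0 <= s <= 1 -> C x -> C y -> C ((1 - s) *: x + s *: y).
Proof.
split=> [cC x y s /andP[s0 s1] Cx Cy|cC x y l].
  have := cC y x (Itv01 s0 s1); rewrite !inE => /(_ Cy Cx).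
  by rewrite /conv/= addrC.
rewrite !inE => Cx Cy; have := cC y x l%:num.
by rewrite ge0 le1 => /(_ isT Cy Cx); rewrite addrC.
Qed.

Section faces.
Context {R : realType} {n : nat}.
Local Notation V := 'rV[R]_n.
Implicit Types (x y t : V) (a s : R) (C F G : set V).
Local Notation convex C := (convex_set (C : set (convex_lmodType V))).

Lemma face_endpoint C F x y s : convex C -> face C F -> C x -> C y ->
  0 < s < 1 -> F ((1 - s) *: x + s *: y) -> F x.
Proof.
move=> /convex_setP cC [_ _ segF] Cx Cy s01 Fs.
apply: (segF x y).
- by move=> _ [r /= r01 <-]; apply: cC => //; move: r01; rewrite in_itv.
- by exists ((1 - s) *: x + s *: y); split=> //; exists s => //=; rewrite in_itv.
- exists 0; first by rewrite /= in_itv/= lexx ler01.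
  by rewrite subr0 scale1r scale0r addr0.
Qed.

Lemma face_subface C F G : F `<=` G -> G `<=` C -> face C F -> face G F.
Proof.
move=> FG GC [_ cF segF]; split=> // x y xyG.
by apply: segF; apply: subset_trans GC.
Qed.

(** * Proper support of a face *)

Definition difference_cone C F : set V :=
  [set v | exists a c f, [/\ 0 <= a, C c, F f & v = a *: (c - f)]].

(** A positive combination [a *: (c - f) + b *: (d - g)] is [a + b] times the
difference of a convex combination of [c], [d] and the one of [f], [g] with the
same weights. *)
Lemma difference_cone_convex C F : convex C -> convex F ->
  C !=set0 -> F !=set0 -> convex_cone (difference_cone C F).
Proof.
move=> /convex_setP cC /convex_setP cF [c0 Cc0] [f0 Ff0]; split.
- by exists 0, c0, f0; rewrite scale0r.
- move=> _ _ [a [c [f [a0 Cc Ff ->]]]] [b [d [g [b0 Cd Fg ->]]]].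
  have [ab0|ab0] := eqVneq (a + b) 0.
    have [-> ->] : a = 0 /\ b = 0 by split; lra.
    by exists 0, c, f; rewrite !scale0r addr0.
  have ab : 0 < a + b by rewrite lt_neqAle eq_sym ab0 addr_ge0.
  pose s := b / (a + b).
  have s01 : 0 <= s <= 1.
    by rewrite divr_ge0 ?addr_ge0//= ler_pdivrMr// mul1r lerDr.
  exists (a + b), ((1 - s) *: c + s *: d), ((1 - s) *: f + s *: g); split.
  + exact: ltW.
  + exact: cC.
  + exact: cF.
  + have -> : a = (a + b) * (1 - s) by rewrite /s; field.
    have {2}-> : b = (a + b) * s by rewrite /s; field.
    rewrite [in RHS](_ : (a + b) * (1 - s) + b = a + b); last by rewrite /s; field.
    rewrite -!scalerA -scalerDr; congr (_ *: _).
    by rewrite !scalerBr opprD addrACA.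
- move=> b _ b0 [a [c [f [a0 Cc Ff ->]]]].
  by exists (b * a), c, f; rewrite mulr_ge0// scalerA.
Qed.

(** If [f - c = a *: (d - g)], then [f + a *: g = c + a *: d]. After division by
[1 + a], the left side is a point of [F] and the right side a point strictly
between [c] and [d], so [c] would be in [F]. *)
Lemma difference_cone_not_linear C F c f : convex C -> face C F ->
  C c -> ~ F c -> F f -> ~ difference_cone C F (f - c).
Proof.
move=> cC fF Cc Fc Ff [a [d [g [a0 Cd Fg fc]]]].
have [_ /convex_setP cF _] := fF.
have [a00|an0] := eqVneq a 0.
  by move: fc; rewrite a00 scale0r => /eqP; rewrite subr_eq0 => /eqP fc;
     rewrite fc in Ff.
have a1 : 0 < 1 + a by lra.
have {}a0 : 0 < a by rewrite lt_neqAle eq_sym an0.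
pose s := a / (1 + a).
have s01 : 0 < s < 1 by rewrite divr_gt0//= ltr_pdivrMr// mul1r; lra.
apply: Fc; apply: (@face_endpoint C F c d s) => //.
have s1 : 1 - s = (1 + a)^-1 by rewrite /s; field; rewrite gt_eqF.
have -> : (1 - s) *: c + s *: d = (1 - s) *: f + s *: g.
  rewrite s1 /s mulrC -!scalerA -!scalerDr; congr (_ *: _).
  rewrite -[f](subrK c) fc scalerBr addrAC subrK addrC; congr (_ + _).
apply: cF => //; case/andP: s01 => s0 s1'.
by rewrite !ltW.
Qed.

(** The definition makes no mention of the common minimum: when [F] is nonempty
and contained in [C], each functional of the cone is constant on [F], where its
minimum over [C] is attained. *)
Definition normal_cone C F : set V :=
  [set t | forall c f, C c -> F f -> dot t f <= dot t c].

Lemma normal_cone_convex C F : convex_cone (normal_cone C F).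
Proof.
split=> [c f _ _|t t' h h' c f Cc Ff|a t a0 h c f Cc Ff].
- by rewrite !dot0l.
- by rewrite !dotDl lerD ?h ?h'.
- by rewrite !dotZl ler_wpM2l ?h.
Qed.

Lemma normal_cone_const C F t f g : F `<=` C -> normal_cone C F t ->
  F f -> F g -> dot t f = dot t g.
Proof.
by move=> FC Nt Ff Fg; apply/eqP; rewrite eq_le !Nt//; exact: FC.
Qed.

(** This is where [F] being a face is used. A convex cone that contains the
opposite of one of its order units is a linear subspace; as the difference cone
is not one, it has a supporting functional that takes the value 1 at an order
unit. *)
Lemma proper_support C F : convex C -> face C F -> F !=set0 -> F <> C ->
  exists t, normal_cone C F t /\
    exists2 c, C c & forall f, F f -> dot t f < dot t c.
Proof.
move=> cC fF F0 FC; have [FsubC cF _] := fF.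
have [c0 [Cc0 Fc0]] : exists c, C c /\ ~ F c.
  apply: contrapT => h; apply: FC; apply/seteqP; split=> // c Cc.
  by apply: contrapT => Fc; apply: h; exists c.
have [f0 Ff0] := F0.
set K := difference_cone C F.
have cK : convex_cone K by apply: difference_cone_convex => //; exists c0.
have [u uK] := cone_has_order_unit cK.
have K_diff c f : C c -> F f -> K (c - f).
  by move=> Cc Ff; exists 1, c, f; rewrite scale1r.
have Ku : ~ K (- u).
  move=> KNu; have [a a0 Ka] := uK.2 _ (K_diff _ _ Cc0 Ff0).
  apply: (difference_cone_not_linear cC fF Cc0 Fc0 Ff0).
  have [_ KD KZ] := cK.
  have := KD _ _ Ka (KZ a _ a0 KNu).
  by rewrite scalerN addrC addKr opprB.
have [t [tu tK]] := cone_supporting_functional cK uK Ku.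
have Nt : normal_cone C F t.
  by move=> c f Cc Ff; rewrite -subr_ge0 -dotBr tK//; exact: K_diff.
exists t; split=> //.
have [[a [c [f [a0 Cc Ff ucf]]]] _] := uK.
exists c => // g Fg; rewrite (normal_cone_const FsubC Nt Fg Ff).
rewrite lt_neqAle Nt// andbT; apply/eqP => tcf.
by move: tu; rewrite ucf dotZr dotBr tcf subrr mulr0 => /esym/eqP; rewrite oner_eq0.
Qed.

(** * Exposed faces and the exposed hull *)

(** Moving from [x] a little in the direction [- t] makes [dot t] smaller. *)
Lemma minimizer_not_interior C t x : t != 0 ->
  (forall c, C c -> dot t x <= dot t c) -> ~ interior C x.
Proof.
move=> t0 xmin /nbhs_ballP[e /= e0 xC].
(* [M] exceeds every coordinate of [t], so the step [e / M] along [t] stays in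
   the ball of radius [e] of the sup norm. *)
pose M := 1 + \sum_i `|t ord0 i|.
have M0 : 0 < M by rewrite ltr_pwDl// sumr_ge0.
have tM i : `|t ord0 i| < M.
  rewrite (@le_lt_trans _ _ (\sum_i `|t ord0 i|))//; last by rewrite ltrDr.
  by rewrite (bigD1 i)//= lerDl sumr_ge0.
have : C (x - (e / M) *: t).
  apply: xC; split=> // i j; rewrite !ord1 !mxE /ball/= opprB addrC subrK.
  rewrite normrM ger0_norm; last by rewrite divr_ge0 ?ltW.
  by rewrite mulrAC ltr_pdivrMr// ltr_pM2l.
move=> /xmin; rewrite dotBr dotZr lerBrDr gerDl leNgt.
by rewrite mulr_gt0 ?dot_self_gt0// divr_gt0.
Qed.

Lemma minimizers_exposed_face C t x : convex C -> t != 0 -> C x ->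
  (forall c, C c -> dot t x <= dot t c) ->
  exposed_face C (C `&` hyperplane t (dot t x)).
Proof.
move=> /convex_setP cC t0 Cx xmin; split; last first.
  exists t, (dot t x); split=> //; split=> //.
  exists x; split=> //; split; first exact: subset_closure.
  exact: (minimizer_not_interior t0).
split; first exact: subIsetl.
  apply/convex_setP => y z s s01 [Cy ty] [Cz tz]; split; first exact: cC.
  by rewrite /hyperplane/= dotDr !dotZr ty tz; ring.
move=> y z yzC [_ [[s /= s01 <-] [_ ts]]] w yzw; split; first exact: yzC.
move: s01; rewrite in_itv/= => /andP[s0 s1].
have seg r : 0 <= r <= 1 -> dot t x <= dot t ((1 - r) *: y + r *: z).
  by move=> r01; apply/xmin/yzC; exists r => //=; rewrite in_itv.
move: ts (seg 0) (seg 1); case: yzw => r _ <-.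
rewrite /hyperplane/= !dotDr !dotZr !lexx ler01 => ts /(_ isT) y0 /(_ isT) z0.
have {}y0 : dot t x <= dot t y by lra.
have {}z0 : dot t x <= dot t z by lra.
(* A mean with positive weights of two values above the minimum equals the
   minimum only if both values do. *)
have ty : dot t y = dot t x.
  apply/eqP; rewrite eq_le y0 andbT leNgt; apply/negP => ty; nra.
have tz : dot t z = dot t x.
  apply/eqP; rewrite eq_le z0 andbT leNgt; apply/negP => tz; nra.
by rewrite ty tz; ring.
Qed.

(** Take for [t] an order unit [u] of the normal cone. Every [w] of the normal
cone satisfies [w x - w f <= a * (u x - u f)] on [C] for some [a], so where [u] is
minimal [w] is minimal as well. Applied to the functionals defining the exposed
faces, this shows that [u] cuts out the hull; applied to the functional of proper
support, that [u] is not constant on [C]. *)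
Lemma exposed_hull_functional C F f : convex C -> face C F -> F f -> F <> C ->
  exists t, [/\ t != 0, normal_cone C F t,
    exposed_hull C F = C `&` hyperplane t (dot t f) &
    exists2 c, C c & dot t c != dot t f].
Proof.
move=> cC fF Ff FC; have [FsubC _ _] := fF.
have [u [Nu uN]] := cone_has_order_unit (normal_cone_convex C F).
have [t [Nt [c Cc tc]]] := proper_support cC fF (ex_intro _ _ Ff) FC.
have le_scaled w : normal_cone C F w -> exists2 a, 0 <= a &
    forall x, C x -> dot w x - dot w f <= a * (dot u x - dot u f).
  move=> /uN[a a0 Na]; exists a => // x Cx.
  by have := Na x f Cx Ff; rewrite !dotBl !dotZl; lra.
have uc : dot u c != dot u f.
  apply/eqP => uc; have [a _ /(_ c Cc)] := le_scaled t Nt.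
  by rewrite uc subrr mulr0 leNgt subr_gt0 tc.
have u0 : u != 0 by apply: contraNN uc => /eqP->; rewrite !dot0l.
exists u; split=> //; last by exists c.
apply/seteqP; split=> x.
  move=> [Cx]; apply; split.
    by apply: minimizers_exposed_face => //; [exact: FsubC|move=> y Cy; exact: Nu].
  by move=> g Fg; split; [exact: FsubC|exact: normal_cone_const Nu Fg Ff].
move=> [Cx ux]; split=> // G /= [[_ [w [a [[_ _ Cw] Gw]]]] FG].
have wF g : F g -> dot w g = a by move=> /FG; rewrite Gw => -[].
have Nw : normal_cone C F w by move=> y g Cy Fg; rewrite wF//; exact: Cw.
rewrite Gw; split=> //; apply/eqP; rewrite /hyperplane/= eq_le; apply/andP; split.
  have [b _ /(_ x Cx)] := le_scaled w Nw.
  by rewrite ux subrr mulr0 subr_le0 (wF _ Ff).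
exact: Cw.
Qed.

Lemma sub_exposed_hull C F : F `<=` C -> F `<=` exposed_hull C F.
Proof. by move=> FC x Fx; split; [exact: FC|move=> G [_]; exact]. Qed.

Lemma exposed_hull_self C : exposed_hull C C = C.
Proof.
apply/seteqP; split; first exact: subIsetl.
exact: sub_exposed_hull.
Qed.

Lemma dot_is_linear t : linear (dot t : V -> R^o).
Proof. by move=> a x y; rewrite dotDr dotZr. Qed.

HB.instance Definition _ t :=
  GRing.isLinear.Build R V R^o _ (dot t) (dot_is_linear t).

(** * Chains of exposed hulls *)

Definition face_chain C F (Fs : seq (set V)) : Prop :=
  (0 < size Fs)%N /\
  (forall i : nat, (i.+1 < size Fs)%N ->
     nth set0 Fs i.+1 `<` nth set0 Fs i) /\
  minimal_exposed_face C F (nth set0 Fs 0) /\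
  (forall i : nat, (i.+1 < size Fs)%N ->
     minimal_exposed_face (nth set0 Fs i) F (nth set0 Fs i.+1)) /\
  F = nth set0 Fs (size Fs).-1.

Lemma face_chain1 C F G :
  face_chain C F [:: G] <-> minimal_exposed_face C F G /\ F = G.
Proof. by split=> [[_ [_ [? [_ ?]]]]|[? ?]]. Qed.

Lemma face_chain_cons C F G H Fs : face_chain C F [:: G, H & Fs] <->
  [/\ minimal_exposed_face C F G, H `<` G & face_chain G F (H :: Fs)].
Proof.
split=> [[_ [dec [CG [mini FE]]]]|[CG HG [_ [dec [GH [mini FE]]]]]].
  split=> //; first exact: (dec 0%N).
  split=> //; split; first by move=> i; exact: (dec i.+1).
  split; first exact: (mini 0%N).
  by split=> // i; exact: (mini i.+1).
split=> //; split; first by case=> [//|i]; exact: dec.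
by split=> //; split=> // -[//|i]; exact: mini.
Qed.

(** Each term is the hull of [F] in its predecessor. The lengths agree too: once
a term equals [F], a further one would be the hull of [F] in [F], that is [F],
contradicting the strict inclusion. *)
Lemma face_chain_unique C F Fs Gs : F `<=` C ->
  face_chain C F Fs -> face_chain C F Gs -> Fs = Gs.
Proof.
have no_tail D G : F = G -> ~ (minimal_exposed_face G F D /\ D `<` G).
  by move=> -> [[-> _]]; rewrite exposed_hull_self => /properxx.
elim: Fs C Gs => [|G Fs IH] C [|G' Gs] FC; [by case|by case|by move=> _ []|].
case: Fs IH => [|H Fs] IH; case: Gs => [|H' Gs].
- by move=> /face_chain1[[-> _] _] /face_chain1[[-> _] _].
- move=> /face_chain1[[-> _] FG] /face_chain_cons[[-> _] H'G [_ [_ [GH' _]]]].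
  by case: (no_tail H' _ FG).
- move=> /face_chain_cons[[-> _] HG [_ [_ [GH _]]]] /face_chain1[[-> _] FG].
  by case: (no_tail H _ FG).
- move=> /face_chain_cons[[-> _] _ cFs] /face_chain_cons[[-> _] _ cGs].
  by congr (_ :: _); apply: IH cFs cGs; exact: sub_exposed_hull.
Qed.

(** Induction on the dimension of a subspace [U] that contains [C - f]. The
functional cutting out the hull [G] vanishes on [G - f] but not on [C - f], so
intersecting [U] with its kernel gives a smaller subspace, which contains
[G - f]. *)
Lemma face_chain_exists C F : convex C -> face C F -> F !=set0 ->
  exists Fs, face_chain C F Fs.
Proof.
move=> cC fF [f Ff].
suff main m (U : {vspace V}) : (\dim U < m)%N ->
    forall C, convex C -> face C F -> (forall c, C c -> c - f \in U) ->
    exists Fs, face_chain C F Fs.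
  by apply: (main _ _ (ltnSn _) C cC fF) => c _; exact: memvf.
elim: m U => [//|m IH] U Um {}C {}cC {}fF CU.
have [FC|FC] := pselect (F = C).
  exists [:: C]; apply/face_chain1; rewrite -FC; split=> //.
  by split=> //; rewrite exposed_hull_self.
have [FsubC _ _] := fF.
have [t [t0 Nt hullE [c Cc tc]]] := exposed_hull_functional cC fF Ff FC.
set G := exposed_hull C F.
have exG : exposed_face C G.
  rewrite /G hullE; apply: minimizers_exposed_face => //; first exact: FsubC.
  by move=> y Cy; exact: Nt.
have CG : minimal_exposed_face C F G by [].
have [[GC cG _] _] := exG.
have FG : F `<=` G by exact: sub_exposed_hull.
pose U' := (U :&: lker (linfun (dot t : V -> R^o)))%VS.
have dimU' : (\dim U' < m)%N.
  apply: (leq_trans _ (_ : \dim U <= m)%N); last by rewrite -ltnS.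
  rewrite (ltn_leqif (dimv_leqif_sup (capvSl _ _))).
  apply/negP => /subvP/(_ _ (CU _ Cc)); rewrite memv_cap memv_ker lfunE/=.
  by rewrite dotBr subr_eq0 (negbTE tc) andbF.
have GU' x : G x -> x - f \in U'.
  rewrite /G hullE => -[Cx tx]; rewrite memv_cap CU// memv_ker lfunE/=.
  by rewrite dotBr tx subrr.
have fG := face_subface FG GC fF.
have [FeqG|FneqG] := pselect (F = G).
  by exists [:: G]; apply/face_chain1.
have [[[]//|H Fs] chain] := IH U' dimU' G cG fG GU'.
exists [:: G, H & Fs].
apply/face_chain_cons; split=> //.
(* The inclusion is strict since the hull of a proper face is proper. *)
have [_ [_ [[/= -> _] _]]] := chain.
have [w [_ _ -> [d Gd wd]]] := exposed_hull_functional cG fG Ff FneqG.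
split; first exact: subIsetl.
by move=> /(_ d Gd)[_ /eqP]; rewrite (negbTE wd).
Qed.

End faces.

Theorem theorem2p5 (R : realType) (n : nat) (C F : set 'rV[R]_n)
    (hC : convex_set (C : set (convex_lmodType 'rV[R]_n)))
    (hF : face C F) (hF0 : F !=set0) :
  exists! Fs : seq (set 'rV[R]_n),
    (0 < size Fs)%N /\
    (forall i : nat, (i.+1 < size Fs)%N ->
       nth set0 Fs i.+1 `<` nth set0 Fs i) /\
    minimal_exposed_face C F (nth set0 Fs 0) /\
    (forall i : nat, (i.+1 < size Fs)%N ->
       minimal_exposed_face (nth set0 Fs i) F (nth set0 Fs i.+1)) /\
    F = nth set0 Fs (size Fs).-1.
Proof.
have [Fs chain] := face_chain_exists hC hF hF0.
exists Fs; split=> // Gs; apply: face_chain_unique chain.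
by case: hF.
Qed.
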